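(* Let $\Gamma$ be a $C^1$ smooth Jordan curve in the plane and let $N\in\mathbb{N}$, $n=2N$. The enhanced semidefinite relaxation of problem (I) is the following problem (IR), in the variables $x=[x^R;x^I]\in\mathbb{R}^{n}$, $X\in\mathcal{S}^{n}$, $F,G\in\mathcal{H}^N$: \[ \begin{array}{rl} \min & \operatorname{tr}(P_0X)\\ \text{s.t.} & Ax=b,\quad AX=bx^T,\quad X\succeq xx^T,\\ & \sum_{p=k+1}^N F_{p,p-k}=x^R_k+i x^I_k,\quad k=0,\dots,N-1,\\ & \sum_{p=k+1}^N G_{p,p-k}=(1-k^2)(x^R_k+i x^I_k),\quad k=0,\dots,N-1,\\ & F\succeq0,\ G\succeq 0. \end{array} \] Problem (I) is feasible. The optimal values $\hat p_1$ of (I) and $\hat p_2$ of (IR) are finite and $\hat p_1=\hat p_2$. If $(\tilde x,\tilde X)$ is (together with some $F,G$) an optimal solution to (IR), then $\tilde x$ is (together with some $F,G$) an optimal solution to (I). Conversely, if $\tilde x$ is an optimal solution to (I), then $(\tilde x,\tilde X)$ with $\tilde X=\tilde x\tilde x^T$ is an optimal solution to (IR).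
   Context: $\mathcal{S}^n$ denotes the real symmetric $n\times n$ matrices, $\mathcal{H}^N$ the complex Hermitian $N\times N$ matrices, $\succeq 0$ means positive semidefinite, and $X\succeq Y$ means $X-Y\succeq0$. Let $\Gamma\subset\mathbb{R}^2$ be a $C^1$ smooth Jordan curve (simple, closed, counterclockwise parameterized by a $C^1$ regular map with periodic boundary conditions), with arc length $s$, total length $L(\Gamma)$, and unit tangent vector $t=(\cos\nu,\sin\nu)^T$, where $\nu$ is the tangent angle. Its complex Fourier length spectrum is $c_k=\int_\Gamma e^{-ik\nu}\,ds$, $k\in\mathbb{Z}$. Vectors $x\in\mathbb{R}^{n}$, $n=2N$, are written $x=[x^R;x^I]$ with $x^R=(x^R_0,\dots,x^R_{N-1})^T$ and $x^I=(x^I_0,\dots,x^I_{N-1})^T$ in $\mathbb{R}^N$. Set \[ P_0=\operatorname{diag}(p_0,\dots,p_{N-1},q_0,\dots,q_{N-1}),\quad p_0=q_0=-\pi,\quad p_k=q_k=2\pi(k^2-1)\ (k\ge1). \] Define $\alpha=(\alpha_0,\dots,\alpha_{N-1})^T,\ \beta=(\beta_0,\dots,\beta_{N-1})^T\in\mathbb{R}^N$ by $\alpha_0=c_0$, $\beta_0=0$, $\alpha_k+i\beta_k=2c_k$ for $k\ge1$, and \[ A=\begin{pmatrix}\alpha^T&\beta^T\\ 0_N^T&e_1^T\end{pmatrix}\in\mathbb{R}^{2\times n},\qquad b=\begin{pmatrix}L(\Gamma)\\0\end{pmatrix}, \] where $0_N$ is the zero vector and $e_1=(1,0,\dots,0)^T$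 in $\mathbb{R}^N$. Problem (I), in the variables $x=[x^R;x^I]\in\mathbb{R}^{n}$ and $F,G\in\mathcal{H}^N$: \[ \begin{array}{rl} \min & x^TP_0x\\ \text{s.t.} & Ax=b,\\ & \sum_{p=k+1}^N F_{p,p-k}=x^R_k+i x^I_k,\quad k=0,\dots,N-1,\\ & \sum_{p=k+1}^N G_{p,p-k}=(1-k^2)(x^R_k+i x^I_k),\quad k=0,\dots,N-1,\\ & F\succeq0,\ G\succeq0. \end{array} \] Optimal values are understood as infima. Enhanced semidefinite relaxation: given a problem with quadratic objective in $x$, a linear equality constraint $Ax=b$, and further linear and linear-matrix-inequality constraints (possibly involving auxiliary variables), one adds the redundant constraint $Axx^T=bx^T$, replaces $xx^T$ by a symmetric matrix variable $X$ in the objective and in this added constraint (so that $x^TP_0x$ becomes $\operatorname{tr}(P_0X)$ and the added constraint becomes $AX=bx^T$), and requires $X\succeq xx^T$. *)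

(* Defs.v *)
From HB Require Import structures.
From mathcomp Require Import all_boot all_order all_algebra.
From mathcomp Require Import all_classical all_reals all_analysis.
From mathcomp Require Import complex.

Set Implicit Arguments.
Unset Strict Implicit.
Unset Printing Implicit Defensive.

Import Order.TTheory GRing.Theory Num.Theory.
Import numFieldNormedType.Exports.

Local Open Scope classical_set_scope.
Local Open Scope ring_scope.
Local Open Scope complex_scope.
Local Open Scope sesquilinear_scope.

Section Curve.
Variable R : realType.
Implicit Types (gamma : R -> R * R) (nu : R -> R).

Definition xcoord gamma : R -> R := fun u => (gamma u).1.
Definition ycoord gamma : R -> R := fun u => (gamma u).2.

Definition C1 (f : R -> R) : Prop :=
  (forall u, derivable f u 1) /\ continuous (derive1 f).

Definition speed gamma (u : R) : R :=
  Num.sqrt (derive1 (xcoord gamma) u ^+ 2 + derive1 (ycoord gamma) u ^+ 2).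

(* The bounded component of the complement of [G], when [G] is a Jordan curve. *)
Definition inside (G : set (R * R)) : set (R * R) :=
  [set p | ~ G p /\ bounded_set (connected_component (~` G) p)].

(* Periodicity on the whole line, together with [C1], encodes the periodic
   boundary conditions on [0, 1] for both [gamma] and its derivative. *)
Definition C1_Jordan_curve gamma : Prop :=
  [/\ C1 (xcoord gamma) /\ C1 (ycoord gamma),
      forall u, gamma (u + 1) = gamma u,
      forall u v, 0 <= u < 1 -> 0 <= v < 1 -> gamma u = gamma v -> u = v &
      forall u, 0 < speed gamma u].

(* The interior lies on the left, in the direction of [(- y', x')]. *)
Definition counterclockwise gamma : Prop :=
  forall u, \forall e \near (0 : R)^'+,
    inside (range gamma)
      (xcoord gamma u - e * derive1 (ycoord gamma) u,
       ycoord gamma u + e * derive1 (xcoord gamma) u).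

(* [nu u] is determined modulo [2 * pi]; no choice of branch is imposed, as
   only [exp (i * k * nu)] with [k] an integer is ever used. *)
Definition tangent_angle gamma nu : Prop :=
  forall u, cos (nu u) = derive1 (xcoord gamma) u / speed gamma u /\
            sin (nu u) = derive1 (ycoord gamma) u / speed gamma u.

(* The integral of [f] along the curve with respect to arc length, [f] being
   given as a function of the parameter. *)
Definition arc_integral gamma (f : R -> R) : R :=
  \int[@lebesgue_measure R]_(u in `[0, 1]) (f u * speed gamma u).

Definition arc_integralC gamma (f : R -> R[i]) : R[i] :=
  arc_integral gamma (fun u => complex.Re (f u)) +i*
  arc_integral gamma (fun u => complex.Im (f u)).

Definition curve_length gamma : R := arc_integral gamma (fun=> 1).

Definition expi (theta : R) : R[i] := cos theta +i* sin theta.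

Definition fourier_length gamma nu (k : int) : R[i] :=
  arc_integralC gamma (fun u => expi (- (k%:~R * nu u))).

End Curve.

Section Psd.

Definition psd_sym (R : realType) n (X : 'M[R]_n) : Prop :=
  X \is symmetricmx /\ forall v : 'cV[R]_n, 0 <= (v^T *m X *m v) 0 0.

Definition psd_herm (R : realType) n (H : 'M[R[i]]_n) : Prop :=
  H \is hermsymmx /\ forall z : 'cV[R[i]]_n, 0 <= (z^t* *m H *m z) 0 0.

End Psd.

Section Programs.
Variable R : realType.

Record program (V : Type) := Program {
  objective : V -> R;
  feasible : set V
}.

Definition opt_value V (P : program V) : \bar R :=
  ereal_inf [set (objective P v)%:E | v in feasible P].

Definition optimal V (P : program V) (v : V) : Prop :=
  feasible P v /\ forall w, feasible P w -> objective P v <= objective P w.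

(* Minimize [x^T Q x] subject to [A x = b] and to the constraints [side x y],
   in the variable [x] and auxiliary variables [y : Aux]. *)
Record quad_data (n m : nat) (Aux : Type) := QuadData {
  quad_mx : 'M[R]_n;
  eq_mx : 'M[R]_(m, n);
  eq_rhs : 'cV[R]_m;
  side : 'cV[R]_n -> Aux -> Prop
}.

Definition quad_program n m Aux (D : quad_data n m Aux) :
    program ('cV[R]_n * Aux) :=
  Program
    (fun '(x, y) => (x^T *m quad_mx D *m x) 0 0)
    (fun '(x, y) => eq_mx D *m x = eq_rhs D /\ side D x y).

(* The constraint [A X = b x^T] comes from the redundant constraint
   [A x x^T = b x^T]; the constraints [side] do not involve [x x^T]. *)
Definition enhanced_relaxation n m Aux (D : quad_data n m Aux) :
    program ('cV[R]_n * 'M[R]_n * Aux) :=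
  Program
    (fun '(x, X, y) => \tr (quad_mx D *m X))
    (fun '(x, X, y) =>
      [/\ X \is symmetricmx,
          eq_mx D *m x = eq_rhs D,
          eq_mx D *m X = eq_rhs D *m x^T,
          psd_sym (X - x *m x^T) &
          side D x y]).

End Programs.

Section Wulff.
Variables (R : realType) (gamma : R -> R * R) (nu : R -> R) (N : nat).
Implicit Types (x : 'cV[R]_(N + N)) (F G : 'M[R[i]]_N).

Definition p_row : 'rV[R]_N :=
  \row_(k < N) if k == 0%N :> nat then - pi else 2 * pi * (k%:R ^+ 2 - 1).

Definition P0 : 'M[R]_(N + N) := diag_mx (row_mx p_row p_row).

(* [fourier_length gamma nu 0] is real, so that [alpha_0] loses nothing. *)
Definition alpha : 'cV[R]_N :=
  \col_(k < N) if k == 0%N :> nat then complex.Re (fourier_length gamma nu 0)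
               else complex.Re (2 * fourier_length gamma nu k%:Z).

Definition beta : 'cV[R]_N :=
  \col_(k < N) if k == 0%N :> nat then 0
               else complex.Im (2 * fourier_length gamma nu k%:Z).

Definition e1 : 'cV[R]_N := \col_(k < N) (k == 0%N :> nat)%:R.

Definition Amx : 'M[R]_(1 + 1, N + N) :=
  block_mx alpha^T beta^T 0 e1^T.

Definition bvec : 'cV[R]_(1 + 1) :=
  col_mx (curve_length gamma)%:M 0.

Definition xcplx x (k : 'I_N) : R[i] := usubmx x k 0 +i* dsubmx x k 0.

(* With indices starting at 0, the entries [F_{p,p-k}], [p = k+1..N], are the
   [F p q] with [p = q + k]. *)
Definition subdiag_sum F (k : 'I_N) : R[i] :=
  \sum_(p < N) \sum_(q < N | p == (q + k)%N :> nat) F p q.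

Definition side_I x (FG : 'M[R[i]]_N * 'M[R[i]]_N) : Prop :=
  let: (F, G) := FG in
  [/\ forall k : 'I_N, subdiag_sum F k = xcplx x k,
      forall k : 'I_N,
        subdiag_sum G k = (1 - k%:R ^+ 2) * xcplx x k,
      psd_herm F &
      psd_herm G].

Definition data_I : quad_data R (N + N) (1 + 1) ('M[R[i]]_N * 'M[R[i]]_N) :=
  QuadData P0 Amx bvec side_I.

Definition problem_I : program R ('cV[R]_(N + N) * ('M[R[i]]_N * 'M[R[i]]_N)) :=
  quad_program data_I.

Definition problem_IR :
    program R ('cV[R]_(N + N) * 'M[R]_(N + N) * ('M[R[i]]_N * 'M[R[i]]_N)) :=
  Program
    (fun '(x, X, (F, G)) => \tr (P0 *m X))
    (fun '(x, X, (F, G)) =>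
      X \is symmetricmx /\
      [/\ Amx *m x = bvec, Amx *m X = bvec *m x^T & psd_sym (X - x *m x^T)] /\
      [/\ forall k : 'I_N, subdiag_sum F k = xcplx x k,
          forall k : 'I_N,
            subdiag_sum G k = (1 - k%:R ^+ 2) * xcplx x k,
          psd_herm F &
          psd_herm G]).

End Wulff.

(* Main.v *)
Require Import Defs.
From mathcomp Require Import all_boot all_order all_algebra.
From mathcomp Require Import all_classical all_reals all_analysis.
From mathcomp Require Import complex.
From mathcomp Require Import ring lra.

(** Put [M_k = \int_Gamma e^(i k nu) ds], so that [M_0] is the length [L], and
    [M_1 = 0] because the curve closes up.  If [(x, X)] is feasible for the
    relaxation, [Y = X - x x^T] is positive semidefinite with [A Y = 0], and
    the relaxed objective exceeds [x^T P_0 x] by [tr (P_0 Y)].  Hence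
    everything rests on [tr (P_0 Y) >= 0] for such [Y]: then dropping [X] and
    completing [x] by [X = x x^T] translate optimal solutions and values
    between the two problems.

    For [Y = v v^T] this inequality says that [v^T P_0 v >= 0] on the kernel
    of [A].  The only negative diagonal entries of [P_0] belong to the two
    coordinates of index [0]; one of these is killed by the second row of [A],
    and the first row expresses the other one, multiplied by [L], through the
    coordinates of index [k >= 2] with coefficients given by [M_k].  By
    Cauchy-Schwarz it is therefore enough that
    [\sum_(2 <= k < N) 2 |M_k|^2 / (k^2 - 1) <= L^2].
    The same argument works for a general [Y] by means of a Cauchy-Schwarz
    inequality for positive semidefinite matrices ([psd_weighted_cauchy],
    [psd_kernel_pivot_le]).

    The inequality on moments expresses that the convex body having the same
    distribution of tangent directions as the curve has nonnegative area.  In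
    terms of the double integral over the curve of a function of
    [t = nu u - nu v], it follows from a pointwise bound on the cosine sum
    [\sum_(k < n) 2 cos (k t) / (k^2 - 1)]: as [n] grows this
    tends to [1 + cos t / 2 - (pi - t) sin t] on [[0, pi]], which is at most
    [1 + cos t / 2 - sin^2 t].  The finite form, with an error [O(1/n)], is
    [weighted_cos_sum_ub].  Integrating it twice
    ([positive_kernel_energy]) and letting [n] go to infinity gives the
    stronger estimate [weighted_moments_le], with [(L^2 + |M_2|^2) / 2] on the
    right.  This is strictly less than [L^2], because the tangent of a closed
    curve cannot keep a constant direction modulo [pi]
    ([second_moment_lt]).  The strict gain also makes the objective of the
    original problem bounded below on its feasible set
    ([quad_P0_bounded]). *)

Set Implicit Arguments.
Unset Strict Implicit.
Unset Printing Implicit Defensive.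

Import Order.TTheory GRing.Theory Num.Theory.
Import numFieldNormedType.Exports.

Local Open Scope ring_scope.

(** * A pointwise bound on a cosine sum *)

Section Kernel.
Context {R : realType}.
Implicit Types (t x : R) (k n : nat).

Definition sine_sum n t : R := \sum_(j < n) sin (j.+1%:R * t) / j.+1%:R.

(** The values [2 / (k^2 - 1)] are, up to normalization, the Fourier
    coefficients of the Green function of [1 + d^2/dt^2] on the circle, with
    the resonant mode [k = 1] and the mean removed. *)
Definition weight k : R := if (k < 2)%N then 0 else 2 / (k%:R ^+ 2 - 1).

Lemma weight_ge0 k : 0 <= weight k.
Proof.
rewrite /weight; case: ltnP => // k2.
rewrite divr_ge0 // subr_ge0 -natrX (ler_nat _ 1) expn_gt0.
by rewrite (leq_trans _ k2).
Qed.

Lemma cosS k t : cos (k.+1%:R * t) = cos (k%:R * t) * cos t - sin (k%:R * t) * sin t.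
Proof. by rewrite -natr1 mulrDl mul1r cosD. Qed.

Lemma sinS k t : sin (k.+1%:R * t) = sin (k%:R * t) * cos t + cos (k%:R * t) * sin t.
Proof. by rewrite -natr1 mulrDl mul1r sinD. Qed.

Lemma cosSS k t : cos (k.+2%:R * t) = 2 * cos t * cos (k.+1%:R * t) - cos (k%:R * t).
Proof.
rewrite (cosS k.+1) sinS cosS.
have := cos2Dsin2 t; move: (cos t) (sin t) (cos (_ * t)) (sin (_ * t)).
by move=> c d ck sk /(congr1 ( *%R ck)); lra.
Qed.

(** [cos (k t)] is a polynomial in [cos t]. *)
Lemma cos_mul_eq t t' : cos t = cos t' ->
  forall k, cos (k%:R * t) = cos (k%:R * t').
Proof.
move=> e k; suff: cos (k%:R * t) = cos (k%:R * t') /\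
  cos (k.+1%:R * t) = cos (k.+1%:R * t') by case.
elim: k => [|k [IH1 IH2]]; first by rewrite !mul0r !mul1r e.
by split=> //; rewrite !cosSS e IH1 IH2.
Qed.

(** Telescoping, as [weight k = 1 / (k - 1) - 1 / (k + 1)] and
    [cos ((j + 1) t) - cos ((j - 1) t) = - 2 sin t sin (j t)]. *)
Lemma weighted_cos_sumE n t :
  \sum_(k < n.+2) weight k * cos (k%:R * t) =
  1 + cos t / 2 - 2 * sin t * sine_sum n t
  - cos (n%:R * t) / n.+1%:R - cos (n.+1%:R * t) / n.+2%:R.
Proof.
elim: n => [|n IH].
  rewrite !big_ord_recr big_ord0 /= /weight /= /sine_sum big_ord0.
  by rewrite !mul0r mul1r cos0; lra.
rewrite big_ord_recr /= IH /sine_sum big_ord_recr /= -/(sine_sum n t).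
have e : 2 * sin t * sin (n.+1%:R * t) = cos (n%:R * t) - cos (n.+2%:R * t).
  rewrite (cosS n.+1) sinS cosS.
  have := cos2Dsin2 t; move: (cos t) (sin t) (cos (_ * t)) (sin (_ * t)).
  by move=> c d ck sk /(congr1 ( *%R ck)); lra.
have -> : weight n.+2 = n.+1%:R^-1 - n.+3%:R^-1.
  rewrite /weight /= -[n.+2%:R]natr1 -[n.+3%:R]natr1 -[n.+2%:R]natr1.
  set m := n.+1%:R; have m0 : 0 < m by rewrite ltr0n.
  have -> : (m + 1) ^+ 2 - 1 = m * (m + 2) by ring.
  by field; rewrite !gt_eqF //; lra.
rewrite mulrDr (mulrA (2 * sin t) (sin _)) e; ring.
Qed.

Lemma dirichlet_kernelE n x :
  sin ((2 * n%:R + 1) * x) =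
  sin x * (1 + \sum_(j < n) 2 * cos (j.+1%:R * (2 * x))).
Proof.
elim: n => [|n IH]; first by rewrite big_ord0 mulr0 add0r addr0 mulr1 mul1r.
rewrite big_ord_recr /= addrA mulrDr -IH.
have -> : (2 * n.+1%:R + 1) * x = n.+1%:R * (2 * x) + x.
  by move: n.+1%:R => m; ring.
have -> : (2 * n%:R + 1) * x = n.+1%:R * (2 * x) - x.
  by rewrite -[n.+1%:R]natr1; ring.
rewrite sinD sinB; ring.
Qed.

Lemma is_derive_sin_mul (c x : R) :
  is_derive x 1 (fun y => sin (c * y)) (c * cos (c * x)).
Proof.
have h : is_derive x 1 ( *%R c) c.
  by apply: is_derive_eq (is_deriveZ c (is_derive_id x (1 : R))) _; rewrite /GRing.scale /= mulr1.
have := @is_derive1_comp R sin ( *%R c) x _ _ (is_derive_sin _) h.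
by rewrite mulrC.
Qed.

Lemma is_derive_cos_mul (c x : R) :
  is_derive x 1 (fun y => cos (c * y)) (- (c * sin (c * x))).
Proof.
have h : is_derive x 1 ( *%R c) c.
  by apply: is_derive_eq (is_deriveZ c (is_derive_id x (1 : R))) _; rewrite /GRing.scale /= mulr1.
have := @is_derive1_comp R cos ( *%R c) x _ _ (is_derive_cos _) h.
by rewrite mulNr mulrC.
Qed.

Lemma is_derive_sine_sum n x :
  is_derive x 1 (fun y => sine_sum n (2 * y))
    (\sum_(j < n) 2 * cos (j.+1%:R * (2 * x))).
Proof.
elim: n => [|n IH].
  rewrite big_ord0 (_ : (fun y => _) = cst 0); first exact: is_derive_cst.
  by apply/funext => y; rewrite /sine_sum big_ord0.
rewrite big_ord_recr /=.
have h := is_deriveZ (n.+1%:R^-1) (is_derive_sin_mul (n.+1%:R * 2) x).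
have := is_deriveD IH h.
set f := (X in is_derive _ _ X _); set g := (X in _ -> is_derive _ _ X _).
have -> : f = g.
  apply/funext => y; rewrite /f /g /sine_sum big_ord_recr /=.
  by rewrite !fctE /GRing.scale /= -mulrA; congr (_ + _); exact: mulrC.
move=> /is_derive_eq; apply; congr (_ + _).
by rewrite /GRing.scale /= !mulrA mulVf ?mul1r // pnatr_eq0.
Qed.

Lemma sin_natmul_pi k : sin (k%:R * pi) = 0 :> R.
Proof.
elim: k => [|k IH]; first by rewrite mul0r sin0.
by rewrite sinS IH sinpi mul0r mulr0 addr0.
Qed.

(** The difference of the two sides vanishes at [pi / 2], and its derivative,
    once the Dirichlet kernel is evaluated, is
    [- (1 + cos (2 x)) - (1 + cos x cos (m x)) / (m sin^2 x) <= 0], where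
    [m = 2 n + 1]. *)
Lemma sine_sum_lb n x : 0 < x <= pi / 2 ->
  sin (2 * x) / 2 - (cos ((2 * n%:R + 1) * x) + cos x) / ((2 * n%:R + 1) * sin x)
  <= sine_sum n (2 * x).
Proof.
set m : R := 2 * n%:R + 1 => /andP[x0 xpi].
have m0 : 0 < m by rewrite /m ltr_wpDl // mulr_ge0.
have pi0 : (0 : R) < pi := pi_gt0 R.
pose F y : R := sine_sum n (2 * y) - 2^-1 * sin (2 * y)
  + m^-1 * ((cos (m * y) + cos y) * (sin y)^-1).
have s0 (y : R) : 0 < y <= pi / 2 -> 0 < sin y.
  by move=> /andP[y0 yp]; apply: sin_gt0_pi; apply/andP; split => //; lra.
have dF (y : R) : 0 < y <= pi / 2 -> is_derive y 1 F
   (- (1 + cos (2 * y)) - (1 + cos y * cos (m * y)) / (m * sin y ^+ 2)).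
  move=> yi; have sy := s0 _ yi.
  have sy0 : sin y != 0 by rewrite gt_eqF.
  have h1 := is_derive_sine_sum n y.
  have h2 := is_deriveZ (2^-1) (is_derive_sin_mul 2 y).
  have h3 := is_deriveD (is_derive_cos_mul m y) (is_derive_cos y).
  have h4 := is_deriveV sy0 (is_derive_sin y).
  have h5 := is_deriveZ (m^-1) (is_deriveM h3 h4).
  apply: is_derive_eq (is_deriveD (is_deriveB h1 h2) h5) _.
  have -> : \sum_(j < n) 2 * cos (j.+1%:R * (2 * y)) = sin (m * y) / sin y - 1.
    by rewrite /m dirichlet_kernelE; field.
  rewrite /GRing.scale /= !fctE.
  have := cos2Dsin2 y.
  move: (sin y) (cos y) (sin (m * y)) (cos (m * y)) sy0 => s c sm cm s0' h.
  have m0' : m != 0 by rewrite gt_eqF.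
  have -> : (1 + c * cm) / (m * s ^+ 2) = (c ^+ 2 + s ^+ 2 + c * cm) / (m * s ^+ 2).
    by rewrite h.
  by field; rewrite m0' s0'.
have F0 : F (pi / 2) = 0.
  rewrite /F; have -> : 2 * (pi / 2) = pi :> R by field.
  have -> : sine_sum n pi = 0.
    rewrite /sine_sum big1 // => j _.
    by rewrite sin_natmul_pi mul0r.
  have -> : m * (pi / 2) = n%:R * pi + pi / 2 by rewrite /m; field.
  by rewrite sinpi cosDpihalf sin_natmul_pi cos_pihalf; lra.
have : F (pi / 2) <= F x.
  apply: (@ler0_derive1_le_oc R F 0 (pi / 2)) => //.
  - by move=> y /[!in_itv] /= /andP[y0 y1]; apply: ex_derive; apply: dF; rewrite y0 ltW.
  - move=> y /[!in_itv] /= /andP[y0 y1].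
    have yi : 0 < y <= pi / 2 by rewrite y0 ltW.
    have [_ dFy] := dF _ yi; rewrite derive1E dFy.
    have c1 : 0 <= 1 + cos (2 * y) by rewrite -lerBlDl sub0r cos_geN1.
    have c2 : 0 <= 1 + cos y * cos (m * y).
      have := cos_max (m * y); have := cos_max y.
      by rewrite !ler_norml => /andP[a1 a2] /andP[b1 b2]; nra.
    have c3 : 0 <= m * sin y ^+ 2 by rewrite mulr_ge0 ?sqr_ge0 // ltW.
    by rewrite -opprD oppr_le0 addr_ge0 // divr_ge0.
  - apply: derivable_within_continuous => y /[!in_itv] /= yi.
    by apply: ex_derive; apply: dF.
  - by rewrite in_itv /= lexx divr_gt0.
  - by rewrite in_itv /= x0.
rewrite F0 /F.
have -> : (cos (m * x) + cos x) / (m * sin x) = m^-1 * ((cos (m * x) + cos x) / sin x).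
  by rewrite invfM mulrCA.
lra.
Qed.

(** The singularity of [sine_sum_lb] at [0] disappears after multiplication by
    [2 sin t], so the error is uniform in [t]. *)
Lemma sine_sum_sin_lb n t : 0 <= t <= pi ->
  sin t ^+ 2 - 8 / n.+1%:R <= 2 * sin t * sine_sum n t.
Proof.
move=> /andP[t0 tpi].
have n0 : (0 : R) < n.+1%:R by rewrite ltr0n.
have [->|tn0] := eqVneq t 0.
  rewrite sin0 mulr0 mul0r expr0n /= sub0r oppr_le0.
  by rewrite divr_ge0 // ltW.
pose x := t / 2.
have tE : t = 2 * x by rewrite /x; field.
have x0 : 0 < x by rewrite divr_gt0 // lt_def tn0.
have xpi : x <= pi / 2 by rewrite ler_pM2r.
have := @sine_sum_lb n x; rewrite x0 xpi => /(_ isT).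
have sx : 0 < sin x.
  by apply: sin_gt0_pi; rewrite x0 /=; have := pi_gt0 R; lra.
have cx : 0 <= cos x by apply: cos_ge0_pihalf; rewrite xpi andbT; have := pi_gt0 R; lra.
set m : R := 2 * n%:R + 1.
have m0 : 0 < m by rewrite /m ltr_wpDl // mulr_ge0.
have mn : n.+1%:R <= m by rewrite /m -natr1 lerD2r ler_peMl // ler1n.
have s2 : sin (2 * x) = 2 * sin x * cos x.
  by rewrite mulr_natl sin_mulr2n -mulr_natl; ring.
rewrite -tE => lb.
have st : 0 <= 2 * sin t by rewrite tE s2 !mulr_ge0 // ltW.
have {lb} := ler_wpM2l st lb.
apply: le_trans.
rewrite mulrBr.
have -> : 2 * sin t * (sin t / 2) = sin t ^+ 2 by field.
rewrite lerD2l lerN2.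
have -> : 2 * sin t * ((cos (m * x) + cos x) / (m * sin x)) =
   4 * cos x * (cos (m * x) + cos x) / m.
  by rewrite tE s2; field; rewrite !gt_eqF.
apply: (@le_trans _ _ (8 / m)); last first.
  by rewrite ler_pM2l // lef_pV2.
rewrite ler_pM2r ?invr_gt0 //.
by have := cos_le1 x; have := cos_le1 (m * x); nra.
Qed.

(** The leading terms of the bound are [1 + cos t / 2 - sin^2 t], written as a
    cosine polynomial in order to be integrated mode by mode. *)
Lemma weighted_cos_sum_ub n t :
  \sum_(k < n.+2) weight k * cos (k%:R * t) <=
  1 / 2 + cos t / 2 + cos (2 * t) / 2 + 10 / n.+1%:R.
Proof.
(* Both sides are functions of [cos t]. *)
wlog /andP[t0 tpi] : t / 0 <= t <= pi.
  move=> H; pose t' := acos (cos t).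
  have ci : -1 <= cos t <= 1 by rewrite cos_geN1 cos_le1.
  have ct : cos t = cos t' by rewrite /t' acosK // in_itv.
  have := H t'; rewrite acos_ge0 // acos_lepi // => /(_ isT).
  rewrite -ct -(cos_mul_eq ct 2).
  by under eq_bigr do rewrite -(cos_mul_eq ct).
rewrite weighted_cos_sumE.
have h := @sine_sum_sin_lb n t; have {}h := h (introT andP (conj t0 tpi)).
have e2 : cos (2 * t) = 1 - 2 * sin t ^+ 2.
  by rewrite mulr_natl cos_mulr2n cos2sin2 -mulr_natl; ring.
have b1 : - cos (n%:R * t) / n.+1%:R <= 1 / n.+1%:R.
  by rewrite ler_pM2r ?invr_gt0 ?ltr0n // lerNl cos_geN1.
have b2 : - cos (n.+1%:R * t) / n.+2%:R <= 1 / n.+1%:R.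
  apply: (@le_trans _ _ (1 / n.+2%:R)).
    by rewrite ler_pM2r ?invr_gt0 ?ltr0n // lerNl cos_geN1.
  by rewrite !mul1r lef_pV2 ?posrE ?ltr0n // ler_nat.
rewrite e2; move: h b1 b2.
move: (cos (n%:R * t)) (cos (n.+1%:R * t)) (n.+1%:R^-1) (n.+2%:R^-1) => a b u v.
by lra.
Qed.

End Kernel.

(** * Arc length integrals and moments of the tangent angle *)

Section Moments.
Context {R : realType}.
Variables (gamma : R -> R * R) (nu : R -> R).

Definition cos_moment (k : nat) : R :=
  arc_integral gamma (fun u => cos (k%:R * nu u)).
Definition sin_moment (k : nat) : R :=
  arc_integral gamma (fun u => sin (k%:R * nu u)).

End Moments.

Local Notation moment2 gamma nu k :=
  (cos_moment gamma nu k ^+ 2 + sin_moment gamma nu k ^+ 2).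

Section ArcIntegral.
Context {R : realType} {gamma : R -> R * R}.
Hypothesis hgamma : C1_Jordan_curve gamma.
Implicit Types (f g : R -> R).

Lemma speed_gt0 u : 0 < speed gamma u.
Proof. by case: hgamma. Qed.

Lemma speed_continuous : continuous (speed gamma).
Proof.
case: hgamma => -[[_ cx] [_ cy]] _ _ _ u.
have h : {for u, continuous (fun u => (xcoord gamma)^`()%classic u ^+ 2 + (ycoord gamma)^`()%classic u ^+ 2)}.
  by apply: cvgD; apply: cvgM; [exact: cx | exact: cx | exact: cy | exact: cy].
apply: (continuous_comp h).
exact: sqrt_continuous.
Qed.

Lemma arc_integrable f : continuous f ->
  (@lebesgue_measure R).-integrable `[0, 1]%classic (EFin \o (fun u => f u * speed gamma u)).
Proof.
move=> cf; apply: continuous_compact_integrable; first exact: segment_compact.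
apply: continuous_subspaceT => u; apply: cvgM; [exact: cf | exact: speed_continuous].
Qed.

Lemma arc_integralD f g : continuous f -> continuous g ->
  arc_integral gamma (fun u => f u + g u) = arc_integral gamma f + arc_integral gamma g.
Proof.
move=> cf cg; rewrite /arc_integral -RintegralD //; try exact: arc_integrable.
by apply: eq_Rintegral => u _; rewrite mulrDl.
Qed.

Lemma arc_integralZ c f : continuous f ->
  arc_integral gamma (fun u => c * f u) = c * arc_integral gamma f.
Proof.
move=> cf; rewrite /arc_integral -RintegralZl //; try exact: arc_integrable.
by apply: eq_Rintegral => u _; rewrite mulrA.
Qed.

Lemma continuous_sum n (f : 'I_n -> R -> R) : (forall i, continuous (f i)) ->
  continuous (fun u => \sum_i f i u).
Proof.
elim: n f => [|n IH] f cf u.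
  by under eq_fun do rewrite big_ord0; exact: cvg_cst.
under eq_fun do rewrite big_ord_recr /=.
by apply: cvgD; [exact: IH | exact: cf].
Qed.

Lemma arc_integral_sum n (f : 'I_n -> R -> R) : (forall i, continuous (f i)) ->
  arc_integral gamma (fun u => \sum_i f i u) = \sum_i arc_integral gamma (f i).
Proof.
elim: n f => [|n IH] f cf.
  rewrite big_ord0 /arc_integral.
  under eq_Rintegral do rewrite big_ord0 mul0r.
  by rewrite /Rintegral integral0.
rewrite big_ord_recr /= -IH //.
rewrite -arc_integralD //; last exact: continuous_sum.
by congr arc_integral; apply/funext => u; rewrite big_ord_recr.
Qed.

Lemma arc_integral_ge0 f : (forall u, 0 <= f u) -> 0 <= arc_integral gamma f.
Proof.
move=> f0; apply: Rintegral_ge0 => u _.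
by rewrite mulr_ge0 // ltW // speed_gt0.
Qed.

Lemma arc_integral_gt0 f (u0 : R) : continuous f -> (forall u, 0 <= f u) ->
  0 < u0 < 1 -> 0 < f u0 -> 0 < arc_integral gamma f.
Proof.
move=> cf f0 /andP[u00 u01] fu0.
pose g u := f u * speed gamma u.
have cg : continuous g by move=> u; apply: cvgM; [exact: cf | exact: speed_continuous].
have g0 u : 0 <= g u by rewrite mulr_ge0 // ltW // speed_gt0.
have gu0 : 0 < g u0 by rewrite mulr_gt0 // speed_gt0.
have : \forall u \near u0, g u0 / 2 < g u.
  by apply: (cvgr_gt _ (cg u0)); rewrite ltr_pdivrMr // ltr_pMr // ltr1n.
case/nbhs_ballP => e /= e0 he.
pose d := Num.min (e / 2) (Num.min u0 (1 - u0)).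
have d0 : 0 < d by rewrite !lt_min divr_gt0 //= u00 subr_gt0.
have de : d < e by rewrite /d gt_min ltr_pdivrMr // ltr_pMr // ltr1n.
have d1 : d <= u0 by rewrite /d !ge_min lexx orbT.
have d2 : d <= 1 - u0 by rewrite /d !ge_min lexx !orbT.
have intg a b (h : R -> R) : continuous h ->
    (@lebesgue_measure R).-integrable `[a, b]%classic (EFin \o h).
  move=> ch; apply: continuous_compact_integrable; first exact: segment_compact.
  exact: continuous_subspaceT.
have c0 : 0 < \int[@lebesgue_measure R]_(u in `[(u0 - d)%R, (u0 + d)%R]%classic) (g u0 / 2).
  rewrite Rintegral_cst // mulr_gt0 //; first by rewrite divr_gt0.
  by rewrite /= lebesgue_measure_itv /= lte_fin ifT -?EFinB /=; lra.
apply: (lt_le_trans c0).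
apply: (@le_trans _ _ (\int[@lebesgue_measure R]_(u in `[(u0 - d)%R, (u0 + d)%R]%classic) g u)).
  apply: le_Rintegral => //; [apply: intg; exact: cst_continuous | exact: intg | ].
  move=> u /=; rewrite in_itv /= => /andP[a b]; apply/ltW/he.
  by rewrite /ball /= ltr_norml; lra.
rewrite /arc_integral /Rintegral fine_le //.
- by apply: integrable_fin_num => //; exact: intg.
- by apply: integrable_fin_num => //; exact: intg.
apply: ge0_subset_integral => //.
- exact: (measurable_int _ (intg 0 1 _ cg)).
- by move=> u _; rewrite lee_fin.
by move=> u /=; rewrite !in_itv /=; lra.
Qed.

Section TangentAngle.
Context {nu : R -> R}.
Hypothesis hnu : tangent_angle gamma nu.

Lemma cos_sin_angle_continuous :
  continuous (fun u => cos (nu u)) /\ continuous (fun u => sin (nu u)).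
Proof.
case: hgamma => -[[_ cx] [_ cy]] _ _ _.
have s0 u : speed gamma u != 0 by rewrite gt_eqF // speed_gt0.
split => u.
  rewrite (_ : (fun u => cos _) = (fun u => (xcoord gamma)^`()%classic u / speed gamma u)).
    by apply: cvgM; [exact: cx | apply: cvgV => //; exact: speed_continuous].
  by apply/funext => v; case: (hnu v).
rewrite (_ : (fun u => sin _) = (fun u => (ycoord gamma)^`()%classic u / speed gamma u)).
  by apply: cvgM; [exact: cy | apply: cvgV => //; exact: speed_continuous].
by apply/funext => v; case: (hnu v).
Qed.

Lemma cos_sin_mul_angle_continuous k :
  continuous (fun u => cos (k%:R * nu u)) /\ continuous (fun u => sin (k%:R * nu u)).
Proof.
have [cc cs] := cos_sin_angle_continuous.
elim: k => [|k [IHc IHs]].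
  by split => u; under eq_fun do rewrite mul0r; exact: cvg_cst.
split => u.
  under eq_fun do rewrite cosS.
  by apply: cvgB; apply: cvgM; [exact: IHc|exact: cc|exact: IHs|exact: cs].
under eq_fun do rewrite sinS.
by apply: cvgD; apply: cvgM; [exact: IHs|exact: cc|exact: IHc|exact: cs].
Qed.

Lemma arc_integral_trig n (p q : nat -> R) :
  arc_integral gamma
    (fun u => \sum_(k < n) (p k * cos (k%:R * nu u) + q k * sin (k%:R * nu u))) =
  \sum_(k < n) (p k * cos_moment gamma nu k + q k * sin_moment gamma nu k).
Proof.
have cc k := (cos_sin_mul_angle_continuous k).1.
have cs k := (cos_sin_mul_angle_continuous k).2.
have cZ (c : R) f : continuous f -> continuous (fun u => c * f u).
  by move=> cf u; apply: cvgM; [exact: cvg_cst | exact: cf].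
rewrite arc_integral_sum; last first.
  by move=> k u; apply: cvgD; apply: cZ; [exact: cc | exact: cs].
apply: eq_bigr => k _; rewrite arc_integralD; try exact: cZ.
by rewrite !arc_integralZ.
Qed.

(** The sum is the double integral along the curve of the cosine polynomial at
    [nu u - nu v]; integrating in [u] for fixed [v] leaves a trigonometric
    polynomial in [nu v], so linearity of the integral is all that is
    needed. *)
Lemma positive_kernel_energy n (c : nat -> R) :
  (forall t, 0 <= \sum_(k < n) c k * cos (k%:R * t)) ->
  0 <= \sum_(k < n) c k * moment2 gamma nu k.
Proof.
move=> c0.
have h v : 0 <= \sum_(k < n) ((c k * cos_moment gamma nu k) * cos (k%:R * nu v)
                           + (c k * sin_moment gamma nu k) * sin (k%:R * nu v)).
  have := @arc_integral_trig n (fun k => c k * cos (k%:R * nu v))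
     (fun k => c k * sin (k%:R * nu v)).
  have -> : \sum_(k < n) (c k * cos (k%:R * nu v) * cos_moment gamma nu k
      + c k * sin (k%:R * nu v) * sin_moment gamma nu k) =
     \sum_(k < n) (c k * cos_moment gamma nu k * cos (k%:R * nu v)
      + c k * sin_moment gamma nu k * sin (k%:R * nu v)).
    by apply: eq_bigr => k _; ring.
  move=> <-; apply: arc_integral_ge0 => u.
  have := c0 (nu u - nu v); congr (0 <= _); apply: eq_bigr => k _.
  by rewrite mulrBr cosB; ring.
have := arc_integral_ge0 h.
rewrite (@arc_integral_trig n (fun k => c k * cos_moment gamma nu k)
  (fun k => c k * sin_moment gamma nu k)).
by congr (0 <= _); apply: eq_bigr => k _; ring.
Qed.

(** The integrals of [x'] and [y'] over a period. *)
Lemma angle_closed : cos_moment gamma nu 1 = 0 /\ sin_moment gamma nu 1 = 0.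
Proof.
case: hgamma => -[[dx cx] [dy cy]] per _ _.
have g01 : gamma 1 = gamma 0 by rewrite -(per 0) add0r.
have key (f : R -> R) : (forall u, derivable f u 1) -> continuous (f^`()%classic) ->
   f 1 = f 0 -> (\int[@lebesgue_measure R]_(u in `[0%R, 1%R]) (f^`()%classic u))%R = 0.
  move=> df cf f01.
  have fat u : {for u, continuous f}.
    by apply: differentiable_continuous; exact/derivable1_diffP.
  have dfLR : derivable_oo_LRcontinuous f 0 1.
    split; first by move=> u _; exact: df.
    - exact/cvg_at_right_filter/fat.
    - exact/cvg_at_left_filter/fat.
  have cf01 : ({within `[(0 : R), 1], continuous f^`()})%classic.
    exact: continuous_subspaceT.
  have := @continuous_FTC2 R (f^`()%classic) f 0 1 ltr01 cf01 dfLR.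
  by rewrite /Rintegral => -> //; rewrite f01 subee.
split.
  rewrite -(key _ dx cx); last by rewrite /xcoord g01.
  apply: eq_Rintegral => u _; rewrite mul1r.
  by case: (hnu u) => -> _; rewrite divfK // gt_eqF // speed_gt0.
rewrite -(key _ dy cy); last by rewrite /ycoord g01.
apply: eq_Rintegral => u _; rewrite mul1r.
by case: (hnu u) => _ ->; rewrite divfK // gt_eqF // speed_gt0.
Qed.

Lemma cos_moment0 : cos_moment gamma nu 0 = curve_length gamma.
Proof. by congr arc_integral; apply/funext => u; rewrite mul0r cos0. Qed.

Lemma sin_moment0 : sin_moment gamma nu 0 = 0.
Proof.
rewrite /sin_moment /arc_integral.
under eq_Rintegral do rewrite mul0r sin0 mul0r.
by rewrite /Rintegral integral0.
Qed.

Lemma curve_length_gt0 : 0 < curve_length gamma.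
Proof.
have c1 : continuous (fun _ : R => 1 : R) by move=> u; exact: cvg_cst.
by apply: (arc_integral_gt0 (u0 := 2^-1)) => //; lra.
Qed.

(** A finite form of the nonnegativity of the area of the convex body with the
    same tangent distribution; the moments of index at least [n] contribute
    nonnegative terms, which is why an arbitrarily fine kernel bound may be
    used. *)
Lemma weighted_moments_le n :
  \sum_(k < n) weight k * moment2 gamma nu k <=
  (curve_length gamma ^+ 2 + moment2 gamma nu 2%N) / 2.
Proof.
have M0 : moment2 gamma nu 0%N = curve_length gamma ^+ 2.
  by rewrite cos_moment0 sin_moment0 expr0n addr0.
have M1 : moment2 gamma nu 1%N = 0 by case: angle_closed => -> ->; rewrite expr0n addr0.
have m0 k : 0 <= weight k * moment2 gamma nu k.
  by rewrite mulr_ge0 ?weight_ge0 // addr_ge0 ?sqr_ge0.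
have step m : (n <= m)%N -> \sum_(k < n) weight k * moment2 gamma nu k <=
    (curve_length gamma ^+ 2 + moment2 gamma nu 2%N) / 2 + 10 * curve_length gamma ^+ 2 / m.+2%:R.
  move=> nm.
  (* The Fourier coefficients of the bound of [weighted_cos_sum_ub]. *)
  pose b (k : nat) : R := nth 0 [:: 1 / 2 + 10 / m.+2%:R; 1 / 2; 1 / 2] k.
  have bE (F : nat -> R) : \sum_(k < m.+3) b k * F k =
      (1 / 2 + 10 / m.+2%:R) * F 0%N + 1 / 2 * F 1%N + 1 / 2 * F 2%N.
    rewrite !big_ord_recl big1 /=; last first.
      by move=> i _; rewrite /b /= nth_nil mul0r.
    by rewrite /b /= addr0 !addrA.
  have pos t : 0 <= \sum_(k < m.+3) (b k - weight k) * cos (k%:R * t).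
    under eq_bigr do rewrite mulrBl.
    rewrite sumrB subr_ge0 (bE (fun k => cos (k%:R * t))).
    have := weighted_cos_sum_ub m.+1 t; move/le_trans; apply.
    by rewrite mul0r cos0 !mul1r; move: (m.+2%:R^-1) (cos (2 * t)) => r s; lra.
  have := @positive_kernel_energy m.+3 (fun k => b k - weight k) pos.
  under eq_bigr do rewrite mulrBl.
  rewrite sumrB subr_ge0 (bE (fun k => moment2 gamma nu k)) M0 M1 => le1.
  apply: (@le_trans _ _ (\sum_(k < m.+3) weight k * moment2 gamma nu k)).
    have nm3 : (n <= m.+3)%N by rewrite (leq_trans nm) // -addn3 leq_addr.
    rewrite (big_ord_widen _ (fun k => weight k * moment2 gamma nu k) nm3) big_mkcond /=.
    by apply: ler_sum => k _; case: ifP.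
  apply: (le_trans le1); move: (m.+2%:R^-1) (curve_length gamma) => r s; lra.
apply/ler_addgt0Pr => e e0.
set r := e^-1 * (10 * curve_length gamma ^+ 2).
pose m := (n + Num.truncn r)%N.
apply: (le_trans (step m (leq_addr _ _))).
rewrite lerD2l ler_pdivrMr ?ltr0n // -ler_pdivrMl // -/r.
apply: (@le_trans _ _ (Num.truncn r).+1%:R); first by rewrite ltW // truncnS_gt.
by rewrite ler_nat /m ltnS -addSn leqW // leq_addl.
Qed.

(** Let [c = cos nu] and [s = sin nu].  The integral of [(p s - q c)^2] is a
    quadratic form in [(p, q)] of determinant [(L^2 - |M_2|^2) / 4].  It is
    positive definite: by Rolle, the tangent is orthogonal to [(p, q)] at some
    point of the closed curve, and there the integrand is [p^2 + q^2]. *)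
Lemma second_moment_lt : moment2 gamma nu 2%N < curve_length gamma ^+ 2.
Proof.
have [cc cs] := cos_sin_angle_continuous.
have cZ (c : R) f : continuous f -> continuous (fun u => c * f u).
  by move=> cf u; apply: cvgM; [exact: cvg_cst | exact: cf].
have I p q : arc_integral gamma (fun u => (p * sin (nu u) - q * cos (nu u)) ^+ 2)
   = p ^+ 2 * (curve_length gamma - cos_moment gamma nu 2) / 2 - p * q * sin_moment gamma nu 2
     + q ^+ 2 * (curve_length gamma + cos_moment gamma nu 2) / 2.
  pose P k := nth 0 [:: (p ^+ 2 + q ^+ 2) / 2; 0; (q ^+ 2 - p ^+ 2) / 2] k.
  pose Q k := nth 0 [:: 0; 0; - (p * q)] k.
  have := @arc_integral_trig 3 P Q.
  rewrite !big_ord_recr big_ord0 /= /P /Q /= cos_moment0 sin_moment0.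
  have -> : (fun u => \sum_(k < 3) (nth 0 [:: (p ^+ 2 + q ^+ 2) / 2; 0; (q ^+ 2 - p ^+ 2) / 2] k * cos (k%:R * nu u) + nth 0 [:: 0; 0; - (p * q)] k * sin (k%:R * nu u)))
     = (fun u => (p * sin (nu u) - q * cos (nu u)) ^+ 2).
    apply/funext => u; rewrite !big_ord_recr big_ord0 /= !mul0r cos0.
    rewrite (cosS 1) (sinS 1) !mul1r.
    have := cos2Dsin2 (nu u); move: (cos _) (sin _) => c s.
    by move=> /(congr1 ( *%R (p ^+ 2 + q ^+ 2))); lra.
  by move=> ->; field.
have Ipos p q : 0 < p ^+ 2 + q ^+ 2 ->
    0 < arc_integral gamma (fun u => (p * sin (nu u) - q * cos (nu u)) ^+ 2).
  move=> pq; case: (hgamma) => -[[dx cx] [dy cy]] per _ _.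
  have g01 : gamma 0 = gamma 1 by rewrite -(per 0) add0r.
  have dh (u : R) : is_derive u 1 (p \*: xcoord gamma + q \*: ycoord gamma)
      (p * (xcoord gamma)^`()%classic u + q * (ycoord gamma)^`()%classic u).
    rewrite !derive1E.
    exact: is_deriveD (is_deriveZ p (derivableP (dx u))) (is_deriveZ q (derivableP (dy u))).
  have [||||u0] := @Rolle R (p \*: xcoord gamma + q \*: ycoord gamma) 0 1.
  - exact: ltr01.
  - by move=> u _; apply: ex_derive; exact: dh.
  - by apply: derivable_within_continuous => u _; apply: ex_derive; exact: dh.
  - by rewrite !fctE /= /xcoord /ycoord /= g01.
  rewrite in_itv /= => u001 [_ h0].
  have [_] := dh u0; rewrite h0 => {}h0.
  have s0 := speed_gt0 u0.
  have [cE sE] := hnu u0.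
  have pcqs : p * cos (nu u0) + q * sin (nu u0) = 0.
    by rewrite cE sE !mulrA -mulrDl -h0 mul0r.
  apply: (arc_integral_gt0 (u0 := u0)) => //.
  - by move=> u; apply: cvgM; apply: cvgB; apply: cZ.
  - by move=> u; rewrite sqr_ge0.
  have := cos2Dsin2 (nu u0); move: (cos _) (sin _) pcqs => c s e h.
  have -> : (p * s - q * c) ^+ 2 = (p ^+ 2 + q ^+ 2) * (c ^+ 2 + s ^+ 2) - (p * c + q * s) ^+ 2 by ring.
  by rewrite h e expr0n mulr1 subr0.
have a0 : 0 < curve_length gamma + cos_moment gamma nu 2.
  by have := Ipos 0 1; rewrite I; lra.
(* At the vector [(L + Re M_2, Im M_2)] the form is its determinant times a
   positive factor. *)
have := Ipos (curve_length gamma + cos_moment gamma nu 2) (sin_moment gamma nu 2).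
rewrite I ltr_wpDr ?sqr_ge0 ?exprn_gt0 // => /(_ isT).
nra.
Qed.

End TangentAngle.

End ArcIntegral.

(** * Positive semidefinite matrices annihilated by a row *)

Section Psd.
Context {R : realType}.

Lemma symmetricmxE n (Y : 'M[R]_n) i j : Y \is symmetricmx -> Y i j = Y j i.
Proof. by move=> /is_hermitianmxP {1}->; rewrite expr0 scale1r !mxE. Qed.

Lemma symmetricmxP n (Y : 'M[R]_n) : Y^T = Y -> Y \is symmetricmx.
Proof. by move=> e; apply/is_hermitianmxP; rewrite expr0 scale1r -[LHS]e; apply/matrixP => i j; rewrite !mxE. Qed.

Lemma psd_rank1 n (v : 'cV[R]_n) : psd_sym (v *m v^T).
Proof.
split; first by apply: symmetricmxP; rewrite trmx_mul trmxK.
move=> w; have -> : w^T *m (v *m v^T) *m w = (w^T *m v) *m (w^T *m v)^T.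
  by rewrite trmx_mul trmxK !mulmxA.
by move: (w^T *m v) => s; rewrite !mxE big_ord1 mxE -expr2 sqr_ge0.
Qed.

Lemma psd_minor n (Y : 'M[R]_n) i j p q : psd_sym Y ->
  0 <= p ^+ 2 * Y i i + 2 * p * q * Y i j + q ^+ 2 * Y j j.
Proof.
move=> [sY /(_ (p *: delta_mx i 0 + q *: delta_mx j 0))].
have E k l : ((delta_mx k 0)^T *m Y *m delta_mx l 0 : 'M[R]_1) 0 0 = Y k l.
  by rewrite trmx_delta -rowE -colE !mxE.
rewrite [(_ + _)^T]linearD /= ![(_ *: _)^T]linearZ /= !mulmxDl !mulmxDr -!scalemxAl -!scalemxAr.
rewrite !mxE.
have := E i i; have := E i j; have := E j i; have := E j j.
rewrite !mxE => -> -> -> ->; rewrite (symmetricmxE j i sY).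
by congr (0 <= _); ring.
Qed.

Lemma psd_diag_ge0 n (Y : 'M[R]_n) i : psd_sym Y -> 0 <= Y i i.
Proof. by move=> /(@psd_minor _ _ i i 1 0); congr (0 <= _); ring. Qed.

(** For [Y = v v^T] this is the Cauchy-Schwarz inequality with weights [d].
    In general, the terms [(i, j)] and [(j, i)] are compared by testing [Y] on
    the vector with entries [a j * d i] at [i] and [- a i * d j] at [j]. *)
Lemma psd_weighted_cauchy n (Y : 'M[R]_n) (P : pred 'I_n) (a d : 'I_n -> R) :
  psd_sym Y -> (forall i, P i -> 0 < d i) ->
  \sum_(i | P i) \sum_(j | P j) a i * a j * Y i j <=
  (\sum_(i | P i) a i ^+ 2 / d i) * \sum_(j | P j) d j * Y j j.
Proof.
move=> pY d0.
set S := \sum_(i | _) _.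
pose f i j := a i ^+ 2 / d i * (d j * Y j j).
have -> : (\sum_(i | P i) a i ^+ 2 / d i) * (\sum_(j | P j) d j * Y j j) =
  \sum_(i | P i) \sum_(j | P j) f i j.
  by rewrite mulr_suml; apply: eq_bigr => i _; rewrite mulr_sumr.
suff : S + S <= \sum_(i | P i) \sum_(j | P j) f i j + \sum_(i | P i) \sum_(j | P j) f j i.
  by rewrite [X in _ <= _ + X]exchange_big /=; lra.
rewrite -!big_split /=; apply: ler_sum => i Pi.
rewrite -!big_split /=; apply: ler_sum => j Pj.
have di := d0 _ Pi; have dj := d0 _ Pj.
have h := @psd_minor _ _ i j (a j * d i) (- (a i * d j)) pY.
rewrite -subr_ge0 /f.
have -> : a i ^+ 2 / d i * (d j * Y j j) + a j ^+ 2 / d j * (d i * Y i i) -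
  (a i * a j * Y i j + a i * a j * Y i j) =
  ((a j * d i) ^+ 2 * Y i i + 2 * (a j * d i) * - (a i * d j) * Y i j +
      (- (a i * d j)) ^+ 2 * Y j j) / (d i * d j).
  by field; rewrite !gt_eqF.
by rewrite divr_ge0 // mulr_ge0 // ltW.
Qed.

(** The relation [r Y = 0], used on rows and on columns, turns
    [r i0 ^+ 2 * Y i0 i0] into the quadratic expression in the remaining
    coefficients of [r] that [psd_weighted_cauchy] bounds. *)
Lemma psd_kernel_pivot_le n (Y : 'M[R]_n) (r d : 'I_n -> R) (i0 z0 : 'I_n) kappa :
  psd_sym Y -> (forall j, \sum_i r i * Y i j = 0) -> (forall j, Y z0 j = 0) ->
  (forall i, i != i0 -> i != z0 -> ~~ (0 < d i) -> r i = 0) ->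
  ~~ (0 < d i0) -> ~~ (0 < d z0) -> i0 != z0 -> r i0 != 0 ->
  \sum_(i | 0 < d i) r i ^+ 2 / d i <= kappa * r i0 ^+ 2 ->
  Y i0 i0 <= kappa * \sum_(i | 0 < d i) d i * Y i i.
Proof.
move=> pY rY zY r0 di0 dz0 iz ri0 le1.
have [sY _] := pY.
have row0 j : r i0 * Y i0 j = - \sum_(i | 0 < d i) r i * Y i j.
  apply/eqP; rewrite -addr_eq0; apply/eqP.
  rewrite -[RHS](rY j) [RHS](bigD1 i0) //=; congr (_ + _).
  rewrite big_mkcond [RHS]big_mkcond /=; apply: eq_bigr => i _.
  case: eqVneq => [->|ni] /=; first by rewrite (negbTE di0).
  case: ifPn => // di.
  by case: (eqVneq i z0) => [->|nz]; rewrite ?zY ?mulr0 // r0 // mul0r.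
have e : r i0 ^+ 2 * Y i0 i0 =
    \sum_(i | 0 < d i) \sum_(j | 0 < d j) r i * r j * Y i j.
  rewrite expr2 -mulrA row0 mulrN mulr_sumr -sumrN; apply: eq_bigr => i _.
  rewrite (symmetricmxE i i0 sY) mulrCA row0 mulrN opprK mulr_sumr.
  by apply: eq_bigr => j _; rewrite (symmetricmxE i j sY) mulrA.
have r2 : 0 < r i0 ^+ 2 by rewrite lt_def sqrf_eq0 ri0 sqr_ge0.
rewrite -(ler_pM2l r2) e; apply: (le_trans (psd_weighted_cauchy (d := d) (P := fun i => 0 < d i) _ pY _)) => //.
rewrite [leRHS]mulrA [r i0 ^+ 2 * kappa]mulrC.
apply: ler_wpM2r; last exact: le1.
by apply: sumr_ge0 => i di; rewrite mulr_ge0 ?psd_diag_ge0 // ltW.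
Qed.

End Psd.

(** * The objective on the kernel of the equality constraints *)

Section Programs.
Context {R : realType} (gamma : R -> R * R) (nu : R -> R) (N : nat).
Hypothesis hgamma : C1_Jordan_curve gamma.
Hypothesis hnu : tangent_angle gamma nu.
Hypothesis hN : (0 < N)%N.

Local Notation L := (curve_length gamma).
Local Notation k0 := (Ordinal hN : 'I_N).
(* The coordinates [x^R_0] and [x^I_0]. *)
Local Notation i0 := (lshift N k0).
Local Notation z0 := (rshift N k0).

Definition length_row : 'rV[R]_(N + N) :=
  row_mx (alpha gamma nu N)^T (beta gamma nu N)^T.

Definition scaled_p_row : 'rV[R]_N :=
  \row_k (if k == 0%N :> nat then -1 else 2 * (k%:R ^+ 2 - 1)).

(** The diagonal of [P0] divided by [pi]. *)
Definition scaled_diag (i : 'I_(N + N)) : R := row_mx scaled_p_row scaled_p_row 0 i.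

Definition tail_trace (Y : 'M[R]_(N + N)) : R := \sum_(i | 0 < scaled_diag i) scaled_diag i * Y i i.

Lemma scaled_p_row_gt0 k : (0 < scaled_p_row 0 k) = (1 < k)%N.
Proof.
rewrite mxE; case: k => -[|[|k]] hk //=; rewrite ?ltr0N1 //.
  by rewrite expr1n subrr mulr0 ltxx.
by rewrite mulr_gt0 // subr_gt0 exprn_egt1 // ltr1n.
Qed.

Lemma ReIm_mul2 (z : R[i]) :
  (complex.Re (2 * z) = 2 * complex.Re z) * (complex.Im (2 * z) = 2 * complex.Im z).
Proof. by case: z => a b; rewrite !mulr_natl !mulr2n. Qed.

Lemma alphaE k : alpha gamma nu N k 0 =
  if k == 0%N :> nat then L else 2 * cos_moment gamma nu k.
Proof.
rewrite mxE; case: eqP => k0'.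
  congr arc_integral; apply/funext => u /=.
  by rewrite mulr0z mul0r oppr0 cos0.
rewrite ReIm_mul2; congr (2 * arc_integral _ _).
by apply/funext => u /=; rewrite cosN.
Qed.

Lemma betaE k : beta gamma nu N k 0 = - 2 * sin_moment gamma nu k.
Proof.
rewrite mxE; case: eqP => k0'.
  by rewrite k0' sin_moment0 mulr0.
rewrite ReIm_mul2 mulNr -mulrN; congr (2 * _).
rewrite -mulN1r -arc_integralZ //; last exact: (cos_sin_mul_angle_continuous hgamma hnu k).2.
congr arc_integral; apply/funext => u /=.
by rewrite sinN mulN1r.
Qed.

Lemma tail_ratioE :
  \sum_(i | 0 < scaled_diag i) length_row 0 i ^+ 2 / scaled_diag i = \sum_(k < N) weight k * moment2 gamma nu k.
Proof.
rewrite big_split_ord /scaled_diag /length_row /=.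
under [X in X + _]eq_bigl do rewrite row_mxEl scaled_p_row_gt0.
under [X in _ + X]eq_bigl do rewrite row_mxEr scaled_p_row_gt0.
rewrite -big_split /= big_mkcond; apply: eq_bigr => k _.
rewrite /weight [(1 < k)%N]leqNgt; case: (ltnP k 2) => k2 /=; first by rewrite mul0r.
rewrite !row_mxEl !row_mxEr ![_^T _ _]mxE alphaE betaE [scaled_p_row _ _]mxE.
have -> : (k == 0%N :> nat) = false by case: (nat_of_ord k) k2.
have : 0 < (k%:R ^+ 2 - 1 : R) by rewrite subr_gt0 exprn_egt1 // ltr1n.
move: (k%:R ^+ 2 - 1) => w w0; field.
by rewrite gt_eqF.
Qed.

Lemma entries_i0 : scaled_diag i0 = -1 /\ length_row 0 i0 = L.
Proof.
rewrite /scaled_diag /length_row !row_mxEl [_^T _ _]mxE alphaE mxE.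
by split.
Qed.

Lemma scaled_diag_z0 : scaled_diag z0 = -1.
Proof. by rewrite /scaled_diag row_mxEr mxE. Qed.

Lemma i0_neq_z0 : i0 != z0.
Proof. by apply/eqP => /(congr1 val) /= /eqP; rewrite addn0 eq_sym; case: N hN. Qed.

(** The modes [k = 1] are invisible: [P0] vanishes there, and so does the first
    row of [A] since the curve is closed. *)
Lemma entries_first_mode i : i != i0 -> i != z0 -> ~~ (0 < scaled_diag i) -> scaled_diag i = 0 /\ length_row 0 i = 0.
Proof.
have [a1 b1] := angle_closed hgamma hnu.
have one (k : 'I_N) : k != k0 -> ~~ (0 < scaled_p_row 0 k) -> nat_of_ord k = 1%N.
  rewrite scaled_p_row_gt0 -leqNgt -val_eqE /= => h1 h2.
  by case: (nat_of_ord k) h1 h2 => [|[|]].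
case: (split_ordP i) => k -> ni nz.
  rewrite /scaled_diag /length_row !row_mxEl => h.
  have k1 : nat_of_ord k = 1%N by apply: one => //; apply: contraNneq ni => ->.
  by rewrite [_^T _ _]mxE alphaE mxE k1 /= a1 mulr0 -[1%:R]/(1 : R) expr1n subrr mulr0.
rewrite /scaled_diag /length_row !row_mxEr => h.
have k1 : nat_of_ord k = 1%N by apply: one => //; apply: contraNneq nz => ->.
by rewrite [_^T _ _]mxE betaE mxE k1 /= b1 mulr0 -[1%:R]/(1 : R) expr1n subrr mulr0.
Qed.

Lemma trace_P0 (Y : 'M[R]_(N + N)) :
  \tr (P0 R N *m Y) = pi * (tail_trace Y - Y i0 i0 - Y z0 z0).
Proof.
have pq i : row_mx (p_row R N) (p_row R N) 0 i = pi * scaled_diag i.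
  have pk k : p_row R N 0 k = pi * scaled_p_row 0 k.
    by rewrite !mxE; case: eqP => _; ring.
  by rewrite /scaled_diag; case: (split_ordP i) => k ->; rewrite ?row_mxEl ?row_mxEr pk.
rewrite /mxtrace; under eq_bigr do rewrite /P0 mul_diag_mx mxE pq -mulrA.
rewrite -mulr_sumr; congr (_ * _).
have [qi _] := entries_i0; have qz := scaled_diag_z0.
rewrite (bigD1 i0) //= (bigD1 z0) /=; last by rewrite eq_sym i0_neq_z0.
rewrite qi qz /tail_trace [X in _ = X - _ - _]big_mkcond /=.
rewrite [X in _ = X - _ - _](bigD1 i0) //= [X in _ = _ + X - _ - _](bigD1 z0) /=; last by rewrite eq_sym i0_neq_z0.
rewrite qi qz ltr0N1 /= add0r add0r.
have -> : \sum_(i | (i != i0) && (i != z0)) scaled_diag i * Y i i =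
  \sum_(i | (i != i0) && (i != z0)) (if 0 < scaled_diag i then scaled_diag i * Y i i else 0).
  apply: eq_bigr => i /andP[ni nz]; case: ifPn => // qi0.
  by have [-> _] := entries_first_mode ni nz qi0; rewrite mul0r.
ring.
Qed.

Lemma AmxE : Amx gamma nu N = col_mx length_row (delta_mx 0 z0).
Proof.
rewrite /Amx /block_mx; congr col_mx.
apply/matrixP => i j; rewrite ord1 [RHS]mxE eqxx /=.
case: (split_ordP j) => k ->; rewrite ?row_mxEl ?row_mxEr !mxE -val_eqE /=.
  by rewrite addn0 ltn_eqF.
by rewrite eqn_add2l.
Qed.

Lemma Amx_mul_eq0 (Y : 'M[R]_(N + N)) : Amx gamma nu N *m Y = 0 ->
  (forall j, \sum_i length_row 0 i * Y i j = 0) /\ (forall j, Y z0 j = 0).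
Proof.
rewrite AmxE mul_col_mx -rowE -[0](@col_mx0 R 1 1) => /eq_col_mx[e1 e2].
split=> j; first by move/matrixP/(_ 0 j): e1; rewrite !mxE.
by move/matrixP/(_ 0 j): e2; rewrite !mxE.
Qed.

Lemma Amx_mulE (x : 'cV[R]_(N + N)) :
  Amx gamma nu N *m x = bvec gamma <-> (length_row *m x) 0 0 = L /\ x z0 0 = 0.
Proof.
rewrite AmxE mul_col_mx -rowE; split.
  move=> /eq_col_mx[/matrixP/(_ 0 0) e1 /matrixP/(_ 0 0) e2].
  by rewrite e1 mxE eqxx mulr1n; move: e2; rewrite !mxE.
move=> [e1 e2]; congr col_mx; apply/matrixP => i j; rewrite !ord1.
  by rewrite e1 mxE eqxx mulr1n.
by rewrite !mxE.
Qed.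

(** [kappa = (L^2 + |M_2|^2) / (2 L^2)]; that it is less than [1] matters for
    [quad_P0_bounded]. *)
Lemma pivot_le : exists2 kappa : R, 0 < kappa < 1 &
  forall Y : 'M[R]_(N + N), psd_sym Y -> Amx gamma nu N *m Y = 0 ->
    Y i0 i0 <= kappa * tail_trace Y.
Proof.
have L0 : 0 < L := curve_length_gt0 hgamma.
have L2 : 0 < L ^+ 2 by rewrite exprn_gt0.
have M2 := second_moment_lt hgamma hnu.
have M2' : 0 <= moment2 gamma nu 2%N by rewrite addr_ge0 ?sqr_ge0.
exists ((L ^+ 2 + moment2 gamma nu 2%N) / 2 / L ^+ 2).
  by rewrite ltr_pdivrMr // mul1r !divr_gt0 ?ltr_pwDl //= -/L in M2 *; lra.
move=> Y pY /Amx_mul_eq0[rY zY].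
have [qi ri] := entries_i0; have qz := scaled_diag_z0.
apply: (psd_kernel_pivot_le (r := fun i => length_row 0 i) (d := scaled_diag) (z0 := z0)) => //.
- by move=> i ni nz qi0; case: (entries_first_mode ni nz qi0).
- by rewrite qi ltr0N1.
- by rewrite qz ltr0N1.
- exact: i0_neq_z0.
- by rewrite ri gt_eqF.
rewrite tail_ratioE ri divfK ?gt_eqF //.
exact: weighted_moments_le.
Qed.

Lemma tail_trace_ge0 (Y : 'M[R]_(N + N)) : psd_sym Y -> 0 <= tail_trace Y.
Proof. by move=> pY; apply: sumr_ge0 => i qi; rewrite mulr_ge0 ?psd_diag_ge0 // ltW. Qed.

Lemma trace_P0_kernel_ge0 (Y : 'M[R]_(N + N)) :
  psd_sym Y -> Amx gamma nu N *m Y = 0 -> 0 <= \tr (P0 R N *m Y).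
Proof.
move=> pY AY; have [kappa /andP[k1 k2] /(_ Y pY AY) le1] := pivot_le.
have [_ zY] := Amx_mul_eq0 AY.
rewrite trace_P0 zY subr0 mulr_ge0 ?pi_ge0 // subr_ge0 (le_trans le1) //.
by rewrite ler_piMl ?tail_trace_ge0 // ltW.
Qed.

Lemma quad_P0E (x : 'cV[R]_(N + N)) :
  (x^T *m P0 R N *m x) 0 0 = \tr (P0 R N *m (x *m x^T)).
Proof. by rewrite mulmxA mxtrace_mulC mulmxA trace_mx11. Qed.

Lemma Amx_delta : Amx gamma nu N *m delta_mx i0 0 = bvec gamma.
Proof.
apply/Amx_mulE; rewrite -colE [col _ _ _ _]mxE; have [_ ->] := entries_i0; split=> //.
by rewrite mxE eq_sym (negbTE i0_neq_z0).
Qed.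

(** Let [v = x - e_0], which lies in the kernel of [A], and let [y] be the
    coordinate of index [0] of [x].  By [pivot_le] for [v v^T], the positive
    part [T] of the objective (divided by [pi]) satisfies
    [(y - 1)^2 <= kappa T], so [T - y^2] is bounded below by the minimum
    [- 1 / (1 - kappa)] of [(y - 1)^2 / kappa - y^2]. *)
Lemma quad_P0_bounded : exists C : R, forall x : 'cV[R]_(N + N),
  Amx gamma nu N *m x = bvec gamma -> C <= (x^T *m P0 R N *m x) 0 0.
Proof.
have [kappa /andP[kap0 kap1] le1] := pivot_le.
exists (- (pi / (1 - kappa))) => x Ax.
pose v := x - delta_mx i0 0.
have Av : Amx gamma nu N *m v = 0 by rewrite mulmxBr Ax Amx_delta subrr.
have := le1 _ (psd_rank1 v); rewrite mulmxA Av mul0mx => /(_ erefl).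
have vE i : i != i0 -> v i 0 = x i 0.
  by move=> ni; rewrite !mxE (negbTE ni) subr0.
have v0 : v i0 0 = x i0 0 - 1 by rewrite !mxE !eqxx.
have sq (w : 'cV[R]_(N + N)) i : (w *m w^T) i i = w i 0 ^+ 2.
  by rewrite mxE big_ord1 mxE -expr2.
have -> : tail_trace (v *m v^T) = tail_trace (x *m x^T).
  apply: eq_bigr => i qi; rewrite !sq vE //.
  by apply: contraTneq qi => ->; have [-> _] := entries_i0; rewrite ltr0N1.
have [_ xz] := (Amx_mulE x).1 Ax.
rewrite quad_P0E trace_P0 !sq v0 xz expr0n subr0 => le2.
have -> : - (pi / (1 - kappa)) = pi * (- (1 - kappa)^-1) by rewrite mulrN.
rewrite ler_wpM2l ?pi_ge0 // -subr_ge0.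
have k2 : 0 < 1 - kappa by rewrite subr_gt0.
move: (tail_trace _) (x i0 0) le2 => T y le2.
have -> : T - y ^+ 2 - - (1 - kappa)^-1 =
  ((1 - kappa) * (kappa * T - (y - 1) ^+ 2) + ((1 - kappa) * (y - 1) - kappa) ^+ 2)
   / (kappa * (1 - kappa)).
  by field; rewrite !gt_eqF.
rewrite divr_ge0 ?addr_ge0 ?sqr_ge0 ?mulr_ge0 ?subr_ge0 //; exact/ltW.
Qed.

Lemma psd_herm_scalar (c : R) : 0 <= c -> psd_herm ((c%:C)%C%:M : 'M[R[i]]_N).
Proof.
move=> c0; split.
  apply/is_hermitianmxP; rewrite expr0 scale1r tr_scalar_mx map_scalar_mx /=.
  by congr (_%:M); rewrite conj_Creal // complex_real.
move=> z; rewrite -mulmxA mul_scalar_mx -scalemxAr mxE mulr_ge0 //; first by rewrite ler0c.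
by rewrite mxE sumr_ge0 // => i _; rewrite !mxE mulrC mul_conjC_ge0.
Qed.

(** The vector [x = e_0] encodes the constant support function of a disc, which
    has the trace representation [F = G = I / N]. *)
Lemma problem_I_feasible : exists v, feasible (problem_I gamma nu N) v.
Proof.
have nN : (N%:R : R) != 0 by rewrite pnatr_eq0 -lt0n.
pose F : 'M[R[i]]_N := ((N%:R^-1)%:C)%C%:M.
have pF : psd_herm F by apply: psd_herm_scalar; rewrite invr_ge0.
have sF k : subdiag_sum F k = (k == 0%N :> nat)%:R.
  rewrite /subdiag_sum; case: eqP => [->|/eqP kn0].
    under eq_bigr => p _.
      under eq_bigl do rewrite addn0 eq_sym.
      by rewrite big_pred1_eq mxE eqxx mulr1n over.
    rewrite sumr_const card_ord -rmorphMn /= -mulr_natr mulVf //.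
  rewrite big1 // => p _; rewrite big1 // => r /eqP pr.
  by rewrite mxE -val_eqE /= pr -[X in _ == X]addn0 eqn_add2l (negbTE kn0).
have xE k : xcplx (delta_mx i0 0 : 'cV[R]_(N + N)) k = (k == 0%N :> nat)%:R.
  rewrite /xcplx !mxE -!val_eqE /= !andbT.
  by rewrite addn_eq0 (gtn_eqF hN); case: (k == 0%N :> nat).
exists (delta_mx i0 0, (F, F)); split => /=; first exact: Amx_delta.
split=> // k; rewrite sF xE //.
by case: eqP => [->|_]; rewrite ?mulr0 // expr0n subr0 mulr1.
Qed.

End Programs.

(** * Exactness of the relaxation *)

Theorem theorem5p2 (R : realType) (gamma : R -> R * R) (nu : R -> R) (N : nat)
    (hgamma : C1_Jordan_curve gamma) (hccw : counterclockwise gamma)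
    (hnu : tangent_angle gamma nu) (hN : (0 < N)%N) :
  let I := problem_I gamma nu N in
  let IR := problem_IR gamma nu N in
  enhanced_relaxation (data_I gamma nu N) = IR /\
  (exists v, feasible I v) /\
  opt_value I \is a fin_num /\
  opt_value IR \is a fin_num /\
  opt_value I = opt_value IR /\
  (forall (x : 'cV[R]_(N + N)) (X : 'M[R]_(N + N)),
     (exists F G, optimal IR (x, X, (F, G))) ->
     exists F G, optimal I (x, (F, G))) /\
  (forall x : 'cV[R]_(N + N),
     (exists F G, optimal I (x, (F, G))) ->
     exists F G, optimal IR (x, x *m x^T, (F, G))).
Proof.
move=> I IR.
have lift_feas x FG : feasible I (x, FG) ->
    feasible IR (x, x *m x^T, FG) /\
    objective IR (x, x *m x^T, FG) = objective I (x, FG).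
  case: FG => F G [/= Ax side]; split; last by rewrite quad_P0E.
  have [symxx _] := psd_rank1 x.
  split=> //; split=> //; split=> //; first by rewrite mulmxA Ax.
  rewrite subrr -(mulmx0 _ (0 : 'cV[R]_(N + N))) -[X in _ *m X]trmx0.
  exact: psd_rank1.
have drop_feas x X FG : feasible IR (x, X, FG) ->
    feasible I (x, FG) /\ objective I (x, FG) <= objective IR (x, X, FG).
  case: FG => F G [/= symX [[Ax AX pY] side]]; split=> //.
  rewrite quad_P0E -subr_ge0 -raddfB /= -mulmxBr.
  by apply: (trace_P0_kernel_ge0 hgamma hnu hN) => //; rewrite mulmxBr mulmxA Ax AX subrr.
have feasI : exists v, feasible I v := problem_I_feasible gamma nu hN.
have optE : opt_value I = opt_value IR.
  apply/eqP; rewrite eq_le; apply/andP; split.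
    apply: le_ereal_inf_tmp => _ [[[x X] FG] /drop_feas[fx le1] <-].
    apply: (@le_trans _ _ (objective I (x, FG))%:E); last by rewrite lee_fin.
    by apply: ereal_inf_lbound; exists (x, FG).
  apply: le_ereal_inf_tmp => _ [[x FG] /lift_feas[fx <-] <-].
  by apply: ereal_inf_lbound; exists (x, x *m x^T, FG).
have optI_fin : opt_value I \is a fin_num.
  have [C hC] := quad_P0_bounded hgamma hnu hN.
  have [v fv] := feasI.
  rewrite fin_numElt; apply/andP; split.
    apply: (@lt_le_trans _ _ C%:E); first by rewrite ltNyr.
    apply: le_ereal_inf_tmp => _ [[x FG] [Ax _] <-].
    by rewrite lee_fin; exact: hC.
  apply: (@le_lt_trans _ _ (objective I v)%:E); last by rewrite ltry.
  by apply: ereal_inf_lbound; exists v.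
split.
  rewrite /IR /enhanced_relaxation /problem_IR; congr Program.
    by apply/funext => -[[x X] [F G]].
  apply/funext => -[[x X] [F G]]; apply/propext; split.
    by move=> [? ? ? ? ?].
  by move=> [? [[? ? ?] ?]].
do 4 (split; first by rewrite -?optE).
split.
  move=> x X [F [G [fx opt]]]; exists F, G.
  have [fI le1] := drop_feas _ _ _ fx; split=> // -[w FG] fw.
  have [fw' <-] := lift_feas _ _ fw.
  exact: le_trans le1 (opt _ fw').
move=> x [F [G [fx opt]]]; exists F, G.
have [fIR eqobj] := lift_feas _ _ fx; split=> // -[[w W] FG] fw.
have [fw' le1] := drop_feas _ _ _ fw.
by rewrite eqobj; exact: le_trans (opt _ fw') le1.
Qed.
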